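(* Let $R$ be a semiring which lacks zero sums. The following are equivalent: (1) $\operatorname{dsoc}(R)=R$, where $\operatorname{dsoc}(R)$ is the decomposition socle of $R$ as a left $R$-module; (2) $R$ has a finite set of orthogonal primitive idempotents whose sum is $1_R$; (3) $R$ is a finite direct sum of indecomposable projective $R$-modules.
   Context: A semiring $(R,+,\cdot,0_R,1_R)$: $(R,+,0_R)$ is a commutative monoid, $(R,\cdot,1_R)$ is a (not necessarily commutative) monoid, multiplication distributes over addition, and $0_Rr=r0_R=0_R$ (so that $R$ is a left module over itself). A (left) $R$-module $V$ is a commutative monoid $(V,+,0_V)$ with scalar multiplication $R\times V\to V$ such that $r(v+w)=rv+rw$, $(r_1+r_2)v=r_1v+r_2v$, $(r_1r_2)v=r_1(r_2v)$, $1_Rv=v$, and $0_Rv=r0_V=0_V$. $R$ lacks zero sums if $a+b=0_R$ implies $a=b=0_R$. For submodules $V_1,\dots,V_n$ of $V$, $V=V_1\oplus\dots\oplus V_n$ means every element of $V$ is uniquely of the form $v_1+\dots+v_n$ with $v_i\in V_i$; a direct summand of $V$ is a submodule $T$ such that $V=T\oplus W$ for some submodule $W$. A module $V\neq\{0_V\}$ is indecomposable if there is no decomposition $V=W_1\oplus W_2$ with $W_1\ne\{0_V\}$ and $W_2\neq\{0_V\}$. The decomposition socle $\operatorname{dsoc}(V)$ is the sum of all indecomposable direct summands of $V$. A module is projective if it is a direct summand of a free $R$-module. An element $e\in R$ is idempotent if $e^2=e$; idempotents $e,f$ are orthogonal if $ef=fe=0_R$; an idempotent is primitive if it cannot be written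 as the sum of two nonzero orthogonal idempotents. *)

(* Defs.v *)
From HB Require Import structures.
From mathcomp Require Import all_boot all_order all_algebra.
From mathcomp Require Import boolp classical_sets cardinality fsbigop.

Set Implicit Arguments.
Unset Strict Implicit.
Unset Printing Implicit Defensive.

Import GRing.Theory.

Local Open Scope classical_set_scope.
Local Open Scope ring_scope.

Definition lacks_zero_sums (R : pzSemiRingType) : Prop :=
  forall a b : R, a + b = 0 -> a = 0 /\ b = 0.

Section Submodules.
Variables (R : pzSemiRingType) (V : lSemiModType R).

Record submodule := Submodule {
  submod_set :> set V;
  submod_closedP : GRing.subsemimod_closed (mem submod_set)
}.

Definition submod_type (W : submodule) : Type := {v : V | v \in (W : set V)}.

HB.instance Definition _ (W : submodule) :=
  [isSub of submod_type W for @sval V (fun v => v \in (W : set V))].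
HB.instance Definition _ (W : submodule) := [Choice of submod_type W by <:].
HB.instance Definition _ (W : submodule) :=
  GRing.SubChoice_isSubLSemiModule.Build R V _ (submod_type W)
    (submod_closedP W).

Definition direct_sum (I : finType) (W : I -> submodule) : Prop :=
  forall v : V, exists! w : {ffun I -> V},
    (forall i, w i \in (W i : set V)) /\ v = \sum_i w i.

Definition direct_sum2 (W1 W2 : submodule) : Prop :=
  direct_sum (fun b : bool => if b then W1 else W2).

Definition direct_summand (T : submodule) : Prop :=
  exists W : submodule, direct_sum2 T W.

Definition indecomposable : Prop :=
  [set: V] <> [set 0] /\
  ~ exists W1 W2 : submodule,
      [/\ direct_sum2 W1 W2, (W1 : set V) <> [set 0] &
          (W2 : set V) <> [set 0]].

Definition is_basis (I : choiceType) (b : I -> V) : Prop :=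
  forall v : V, exists! c : I -> R,
    finite_set [set i | c i <> 0] /\ v = \sum_(i \in [set: I]) c i *: b i.

Definition free_module : Prop :=
  exists (I : choiceType) (b : I -> V), is_basis b.

End Submodules.

Coercion submod_lSemiMod (R : pzSemiRingType) (V : lSemiModType R)
  (W : submodule V) : lSemiModType R := submod_type W.

Section Modules.
Variables (R : pzSemiRingType) (V : lSemiModType R).

(* Sums of a possibly infinite family of submodules are finite sums of
   elements of its members; the empty sum is 0. *)
Definition dsoc : set V :=
  [set v | exists (n : nat) (T : 'I_n -> submodule V) (t : 'I_n -> V),
     (forall i, [/\ direct_summand (T i), indecomposable (T i) &
                    t i \in (T i : set V)]) /\
     v = \sum_i t i].

Definition isomorphic (U : lSemiModType R) : Prop :=
  exists f : {linear V -> U}, bijective f.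

End Modules.

Arguments dsoc {R} V _ : assert.

(* Being a direct summand of a free module is understood up to isomorphism. *)
Definition projective (R : pzSemiRingType) (V : lSemiModType R) : Prop :=
  exists (F : lSemiModType R) (T : submodule F),
    [/\ free_module F, direct_summand T & isomorphic V T].

Section Idempotents.
Variable R : pzSemiRingType.

Definition idempotent_elt (e : R) : Prop := e * e = e.

Definition orthogonal_elts (e f : R) : Prop := e * f = 0 /\ f * e = 0.

(* 0 is not excluded: it counts as primitive whenever R lacks zero sums. *)
Definition primitive_idempotent (e : R) : Prop :=
  idempotent_elt e /\
  ~ exists f g : R,
      [/\ idempotent_elt f /\ f <> 0, idempotent_elt g /\ g <> 0,
          orthogonal_elts f g & e = f + g].

End Idempotents.

(* Main.v *)
Require Import Defs.
From HB Require Import structures.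
From mathcomp Require Import all_boot all_order all_algebra.
From mathcomp Require Import boolp classical_sets cardinality fsbigop.

Set Implicit Arguments.
Unset Strict Implicit.
Unset Printing Implicit Defensive.

Import GRing.Theory.

Local Open Scope classical_set_scope.
Local Open Scope ring_scope.

(** Applying a decomposition of R into left ideals to the element 1 gives a
    complete family of orthogonal idempotents e_i, and the summands are the
    R e_i; an R e with e idempotent is indecomposable iff e is nonzero and
    primitive.  When R lacks zero sums, complemented idempotents commute:
    if e + f = 1 and e' + f' = 1, then 0 = e f = e e' f + e f' f forces
    e e' f = 0, so e e' = e e' e, and 0 = f e forces f e' e = 0 likewise, so
    e' e = e e' e.  Hence the idempotents of two indecomposable summands are
    equal or orthogonal, and if dsoc(R) = R their distinct values sum to 1. *)

(** * Existence and uniqueness of components in direct sums of submodules *)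

Section DirectSums.
Variables (R : pzSemiRingType) (V : lSemiModType R).

Lemma submodule_eq (A B : submodule V) : submod_set A = submod_set B -> A = B.
Proof.
case: A B => [A cA] [B cB] /= eqAB; case: B / eqAB cB => cB.
by rewrite (Prop_irrelevance cA cB).
Qed.

(* [A v] would denote membership of v in the carrier type of A, through the
   coercion to lSemiModType, hence the explicit projection. *)
Lemma submod0 (A : submodule V) : submod_set A 0.
Proof. by have [[A0 _] _] := submod_closedP A; exact: set_mem A0. Qed.

Lemma submodZ (A : submodule V) (r : R) v :
  submod_set A v -> submod_set A (r *: v).
Proof.
have [_ AZ] := submod_closedP A.
by move=> Av; apply: set_mem (AZ r v _); apply: mem_set.
Qed.

Lemma submod_neq0 (A : submodule V) :
  (A : set V) <> [set 0] <-> exists2 v, submod_set A v & v <> 0.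
Proof.
split=> [nzA|[v Av nzv] eqA]; last by move: Av; rewrite eqA.
apply: contrapT => noA; apply: nzA; apply/seteqP; split=> v /=.
  by move=> Av; apply: contrapT => nzv; apply: noA; exists v.
by move=> ->; apply: submod0.
Qed.

(** Trades the finite functions and boolean membership of [direct_sum] for plain functions and
    [Prop] membership. *)
Lemma direct_sumP (I : finType) (W : I -> submodule V) :
  direct_sum W <->
  (forall v, exists2 w : I -> V,
     forall i, submod_set (W i) (w i) & v = \sum_i w i) /\
  (forall w w' : I -> V,
     (forall i, submod_set (W i) (w i)) -> (forall i, submod_set (W i) (w' i)) ->
     \sum_i w i = \sum_i w' i -> w =1 w').
Proof.
split=> [dW|[exW unW] v].
  split=> [v|w w' Ww Ww' eqw i].
    have [w [[Ww ->] _]] := dW v.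
    by exists w => // i; apply: set_mem.
  have [u [_ uniqu]] := dW (\sum_i w i).
  have uE z : (forall i, submod_set (W i) (z i)) -> \sum_i w i = \sum_i z i ->
      u = [ffun i => z i].
    move=> Wz eqz; apply: uniqu; split=> [j|]; first by rewrite ffunE mem_set.
    by rewrite eqz; apply: eq_bigr => j _; rewrite ffunE.
  by have := uE w' Ww' eqw; rewrite (uE w Ww erefl) => /ffunP/(_ i); rewrite !ffunE.
have [w Ww ->] := exW v; exists [ffun i => w i]; split.
  split=> [i|]; first by rewrite ffunE mem_set.
  by apply: eq_bigr => i _; rewrite ffunE.
move=> w' [Ww' eqw]; apply/ffunP=> i; rewrite ffunE.
by apply: (unW _ _ _ _ eqw) => // j; apply: set_mem.
Qed.

Lemma direct_sum2P (A B : submodule V) :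
  direct_sum2 A B <->
  (forall v, exists a b, [/\ submod_set A a, submod_set B b & v = a + b]) /\
  (forall a b a' b',
     submod_set A a -> submod_set B b -> submod_set A a' -> submod_set B b' ->
     a + b = a' + b' -> a = a' /\ b = b').
Proof.
split=> [/direct_sumP[exW unW]|[exW unW]].
  split=> [v|a b a' b' Aa Bb Aa' Bb' eqab].
    have [w Ww ->] := exW v; exists (w true), (w false).
    by split; [apply: Ww true|apply: Ww false|rewrite big_bool].
  have eqw : (fun c : bool => if c then a else b)
      =1 (fun c : bool => if c then a' else b').
    by apply: unW; [case|case|rewrite !big_bool].
  by split; [apply: (eqw true)|apply: (eqw false)].
apply/direct_sumP; split=> [v|w w' Ww Ww'].
  have [a [b [Aa Bb ->]]] := exW v; exists (fun c : bool => if c then a else b).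
    by case.
  by rewrite big_bool.
rewrite !big_bool => /(unW _ _ _ _ (Ww true) (Ww false) (Ww' true) (Ww' false)).
by move=> [eqt eqf] [].
Qed.

End DirectSums.

(** * Left ideal decompositions of [R] and idempotents *)

Section Principal.
Variable R : pzSemiRingType.
Implicit Types e f : R.

Lemma right_fixed_closed e :
  GRing.subsemimod_closed (mem [set x : R^o | (x : R) * e = x :> R]).
Proof.
split; first split.
- by rewrite inE /= mul0r.
- by move=> x y; rewrite !inE /= mulrDl => -> ->.
- by move=> a x; rewrite !inE /= -mulrA => ->.
Qed.

(* For idempotent e this is the left ideal R e. *)
Definition principal e : submodule R^o := Submodule (right_fixed_closed e).

Definition complete_orthogonal (I : finType) (e : I -> R) : Prop :=
  (forall i j, e i * e j = if i == j then e i else 0) /\ \sum_i e i = 1.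

(** The [e i] are the components of [1], and the component of any [x] in [W i] is [x * e i]. *)
Lemma regular_direct_sumP (I : finType) (W : I -> submodule R^o) :
  direct_sum W <->
  exists2 e : I -> R, complete_orthogonal e & forall i, W i = principal (e i).
Proof.
split=> [/direct_sumP[exW unW]|[e [ortho sum1] WE]].
  have [e We sum1] := exW (1 : R).
  (* The family [x * e j] and the family equal to [x] at [i] and [0] elsewhere both decompose [x],
     so they agree. *)
  have We_eq i (x : R) : submod_set (W i) x ->
      forall j, x * e j = if i == j then x else 0.
    move=> Wx; apply: unW => [j|j|].
    - exact: (submodZ x (We j)).
    - by case: eqP => [<-//|_]; apply: submod0.
    - rewrite -mulr_sumr -sum1 mulr1 -big_mkcond.
      by rewrite (eq_bigl (pred1 i)) ?big_pred1_eq //.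
  exists e; first by split=> // i j; apply: We_eq.
  move=> i; apply: submodule_eq; apply/seteqP; split=> x /= => [Wx|xe].
    by have := We_eq i x Wx i; rewrite eqxx.
  by rewrite -xe; apply: (submodZ (x : R) (We i)).
apply/direct_sumP; split=> [x|w w' Ww Ww' eqw i].
  exists (fun i => x * e i); last by rewrite -mulr_sumr sum1 mulr1.
  by move=> i; rewrite WE /= -mulrA ortho eqxx.
(* Right multiplication by [e i] fixes the component in [W i] and kills the others, hence
   uniqueness. *)
have comp z : (forall j, submod_set (W j) (z j)) -> z i = (\sum_j z j : R) * e i.
  move=> Wz; rewrite mulr_suml (bigD1 i) //= big1 ?addr0 => [|j /negPf nji].
    by have := Wz i; rewrite WE.
  have := Wz j; rewrite WE /= => <-.
  by rewrite -mulrA ortho nji mulr0.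
by rewrite (comp _ Ww) eqw -comp.
Qed.

Lemma complemented_idempotent e f :
  e + f = 1 -> e * f = 0 -> idempotent_elt e /\ idempotent_elt f.
Proof.
move=> ef1 ef; split; rewrite /idempotent_elt.
  by rewrite -[RHS]mulr1 -ef1 mulrDr ef addr0.
by rewrite -[RHS]mul1r -ef1 mulrDl ef add0r.
Qed.

Lemma regular_summandP (T : submodule R^o) :
  direct_summand T <->
  exists e f, [/\ e + f = 1, e * f = 0, f * e = 0 & T = principal e].
Proof.
split=> [[W /regular_direct_sumP[e [ortho sum1] WE]]|[e [f [ef1 ef fe ->]]]].
  exists (e true), (e false); split; last exact: (WE true).
  - by rewrite -sum1 big_bool.
  - exact: (ortho true false).
  - exact: (ortho false true).
exists (principal f); apply/regular_direct_sumP.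
exists (fun b : bool => if b then e else f); last by case.
split; last by rewrite big_bool.
have [ee ff] := complemented_idempotent ef1 ef.
by case; case.
Qed.

(** The complement is generated by the sum of the other idempotents. *)
Lemma regular_direct_summand (I : finType) (W : I -> submodule R^o) (i : I) :
  direct_sum W -> direct_summand (W i).
Proof.
move=> /regular_direct_sumP[e [ortho sum1] WE]; apply/regular_summandP.
exists (e i), (\sum_(j | j != i) e j); split; last exact: WE.
- by rewrite -sum1 [RHS](bigD1 i).
- rewrite mulr_sumr big1 // => j /negPf nji.
  by rewrite ortho eq_sym nji.
- by rewrite mulr_suml big1 // => j /negPf nji; rewrite ortho nji.
Qed.

(** Hides the subtype behind an abstract injection [v], so that equations in [principal e] are
    computed in [R]. *)
Lemma principal_embedding e : exists v : principal e -> R,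
  [/\ injective v, {morph v : x y / x + y},
      forall (a : R) (x : principal e), v (a *: x) = a * v x,
      forall x, v x * e = v x & forall h, h * e = h -> exists x, v x = h].
Proof.
exists (fun x => val x); split=> //; first exact: val_inj.
  by case=> x /= /set_mem.
move=> h he; have hmem : (h : R^o) \in (principal e : set R^o) by rewrite inE.
by exists (exist _ (h : R^o) hmem).
Qed.

(** An orthogonal splitting [e = f + g] splits R e into R f and R g; conversely, the components of
    [e] in a decomposition of R e are orthogonal idempotents. *)
Lemma indecomposable_principalP e : idempotent_elt e ->
  indecomposable (principal e) <-> e <> 0 /\ primitive_idempotent e.
Proof.
move=> ee; have [v [vinj vD vZ ve vsurj]] := principal_embedding e.
have v0 : v 0 = 0 by rewrite -(scale0r 0) vZ mul0r.
split=> [[nz0 indec]|[nze [_ prim]]].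
  split=> [e0|].
    apply: nz0; apply/seteqP; split=> // x _ /=.
    by apply: vinj; rewrite v0 -ve [X in _ * X]e0 mulr0.
  split=> // -[f [g [[ff nzf] [gg nzg] [fg gf] efg]]]; apply: indec.
  have [x vx] : exists x, v x = f by apply: vsurj; rewrite efg mulrDr ff fg addr0.
  have [y vy] : exists y, v y = g by apply: vsurj; rewrite efg mulrDr gg gf add0r.
  (* For [f] and [g] these fixed points are the left ideals R f and R g, seen inside
     [principal e]. *)
  have cl h : GRing.subsemimod_closed
      (mem [set z : principal e | v z * h = v z]).
    split; first split.
    - by rewrite inE /= v0 mul0r.
    - by move=> z z'; rewrite !inE /= vD mulrDl => -> ->.
    - by move=> a z; rewrite !inE /= vZ -mulrA => ->.
  exists (Submodule (cl f)), (Submodule (cl g)); split.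
  - apply/direct_sum2P; split=> [z|a b a' b' /= af bg a'f b'g eqab].
      exists (v z *: x), (v z *: y); split=> /=.
      + by rewrite vZ vx -mulrA ff.
      + by rewrite vZ vy -mulrA gg.
      + by apply: vinj; rewrite vD !vZ vx vy -mulrDr -efg ve.
    have ag z : v z * f = v z -> v z * g = 0.
      by move=> <-; rewrite -mulrA fg mulr0.
    have bf z : v z * g = v z -> v z * f = 0.
      by move=> <-; rewrite -mulrA gf mulr0.
    have /(congr1 v) := eqab; rewrite !vD => eqv.
    split; apply: vinj.
      by have := congr1 (fun z => z * f) eqv;
         rewrite !mulrDl af a'f !bf // !addr0.
    by have := congr1 (fun z => z * g) eqv;
       rewrite !mulrDl bg b'g !ag // !add0r.
  - apply/submod_neq0; exists x => [/=|x0]; first by rewrite vx.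
    by apply: nzf; rewrite -vx x0 v0.
  - apply/submod_neq0; exists y => [/=|y0]; first by rewrite vy.
    by apply: nzg; rewrite -vy y0 v0.
have [u vu] : exists u, v u = e by apply: vsurj.
split.
  move=> all0; have : [set: principal e] u by []; rewrite all0 => /= u0.
  by apply: nze; rewrite -vu u0 v0.
move=> [A [B [/direct_sum2P[exAB unAB]]]].
move=> /submod_neq0[x Ax nzx] /submod_neq0[y By nzy].
have [a [b [Aa Bb eab]]] := exAB u; apply: prim.
(* [u] stands for [e], a right identity on R e: expanding [z = z e] with [e = a + b] gives the
   components of [z]. *)
have coordE z : z = v z *: a + v z *: b.
  by rewrite -scalerDr -eab; apply: vinj; rewrite vZ vu ve.
have coordA z : submod_set A z -> z = v z *: a /\ 0 = v z *: b.
  move=> Az; apply: unAB; rewrite ?addr0 -?coordE //; try exact: submodZ.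
  exact: submod0.
have coordB z : submod_set B z -> 0 = v z *: a /\ z = v z *: b.
  move=> Bz; apply: unAB; rewrite ?add0r -?coordE //; try exact: submodZ.
  exact: submod0.
(* Taking [z] to be [a], then [b], yields [a a = a], [a b = 0], [b a = 0] and [b b = b]. *)
have [/(congr1 v) aa /(congr1 v) ab] := coordA a Aa.
have [/(congr1 v) ba /(congr1 v) bb] := coordB b Bb.
rewrite vZ in aa; rewrite vZ v0 in ab; rewrite vZ v0 in ba; rewrite vZ in bb.
exists (v a), (v b); split; [split|split|split|] => //.
(* If [a] vanished, so would every [x = x a] in [A]. *)
- move=> a0; apply: nzx; have [-> _] := coordA x Ax.
  by apply: vinj; rewrite vZ a0 mulr0 v0.
- move=> b0; apply: nzy; have [_ ->] := coordB y By.
  by apply: vinj; rewrite vZ b0 mulr0 v0.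
- by rewrite -vD -eab.
Qed.

(** The single element [1] is a basis, the coefficient of [v] being [v] itself. *)
Lemma regular_free : free_module R^o.
Proof.
exists unit, (fun=> 1) => v; exists (fun=> v); split.
  split; first exact: finite_finset.
  by rewrite (_ : [set: unit] = [set tt]) ?fsbig_set1 ?[RHS]mulr1 //;
     apply/seteqP; split=> -[].
move=> c [_ ->]; apply/funext => -[].
by rewrite (_ : [set: unit] = [set tt]) ?fsbig_set1 ?[LHS]mulr1 //;
   apply/seteqP; split=> -[].
Qed.

Lemma projective_regular_summand (T : submodule R^o) :
  direct_summand T -> projective T.
Proof.
move=> dT; exists R^o, T; split=> //; first exact: regular_free.
by exists idfun; exists id.
Qed.

(** The absence of zero sums enters here: it makes both terms of [e (e' + f') f = e f = 0] vanish,
    and likewise with [e] and [f] exchanged. *)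
Lemma complemented_idempotents_commute e f e' f' : lacks_zero_sums R ->
  e + f = 1 -> e * f = 0 -> f * e = 0 -> e' + f' = 1 -> e * e' = e' * e.
Proof.
move=> hR ef1 ef fe ef1'.
have [eef _] : e * e' * f = 0 /\ e * f' * f = 0.
  by apply: hR; rewrite -mulrDl -mulrDr ef1' mulr1.
have [fee _] : f * e' * e = 0 /\ f * f' * e = 0.
  by apply: hR; rewrite -mulrDl -mulrDr ef1' mulr1.
have -> : e * e' = e * e' * e by rewrite -[LHS]mulr1 -ef1 mulrDr eef addr0.
by rewrite -[e' * e in RHS]mul1r -ef1 mulrDl !mulrA fee addr0.
Qed.

Lemma primitive_idempotent_absorb e e' f' :
  primitive_idempotent e -> idempotent_elt e' -> idempotent_elt f' ->
  e' + f' = 1 -> e' * f' = 0 -> f' * e' = 0 ->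
  e * e' = e' * e -> e * f' = f' * e -> e * e' = 0 \/ e * e' = e.
Proof.
move=> [ee prim] ee' ff' ef1' ef' fe' come comf.
have mulee x y : e * x = x * e -> (e * x) * (e * y) = e * (x * y).
  by move=> comx; rewrite mulrA -(mulrA e x) -comx mulrA ee -mulrA.
have [|nz] := pselect (e * e' = 0); [by left|right].
have [ef0|nzf] := pselect (e * f' = 0).
  by rewrite -[RHS]mulr1 -ef1' mulrDr ef0 addr0.
case: prim; exists (e * e'), (e * f'); split.
- by split=> //; rewrite /idempotent_elt mulee // ee'.
- by split=> //; rewrite /idempotent_elt mulee // ff'.
- by split; rewrite mulee // ?ef' ?fe' mulr0.
- by rewrite -mulrDr ef1' mulr1.
Qed.

(** Absorption is applied both ways: if [e e'] is nonzero, it equals [e] and, by commutation, also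
    [e']. *)
Lemma primitive_complemented_eq_or_orthogonal e f e' f' : lacks_zero_sums R ->
  primitive_idempotent e -> e + f = 1 -> e * f = 0 -> f * e = 0 ->
  primitive_idempotent e' -> e' + f' = 1 -> e' * f' = 0 -> f' * e' = 0 ->
  e = e' \/ orthogonal_elts e e'.
Proof.
move=> hR pe ef1 ef fe pe' ef1' ef' fe'.
have com := complemented_idempotents_commute hR ef1 ef fe ef1'.
have comf : e * f' = f' * e.
  by apply: (complemented_idempotents_commute hR ef1 ef fe);
    exact: etrans (addrC _ _) ef1'.
have comf' : e' * f = f * e'.
  by apply: (complemented_idempotents_commute hR ef1' ef' fe');
    exact: etrans (addrC _ _) ef1.
have [_ idf] := complemented_idempotent ef1 ef.
have [_ idf'] := complemented_idempotent ef1' ef'.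
have [ee'|ee'] := primitive_idempotent_absorb pe pe'.1 idf' ef1' ef' fe' com comf.
  by right; split=> //; rewrite -com.
have [e'e|e'e] :=
    primitive_idempotent_absorb pe' pe.1 idf ef1 ef fe (esym com) comf'.
  by right; split=> //; rewrite com.
by left; rewrite -ee' com.
Qed.

End Principal.

Theorem theorem3p3 (R : pzSemiRingType) (hR : lacks_zero_sums R) :
  [<-> dsoc R^o = [set: R^o];
       exists E : set R,
         [/\ finite_set E,
             forall e, E e -> primitive_idempotent e,
             forall e f, E e -> E f -> e <> f -> orthogonal_elts e f &
             \sum_(e \in E) e = 1];
       exists (n : nat) (W : 'I_n -> submodule R^o),
         direct_sum W /\
         (forall i, indecomposable (W i) /\ projective (W i))].
Proof.
tfae.
- move=> dsocR; have [n [T [t [Tt sum1]]]] : dsoc R^o 1 by rewrite dsocR.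
  have exe i : exists ef : R * R, [/\ ef.1 + ef.2 = 1, ef.1 * ef.2 = 0,
      ef.2 * ef.1 = 0, primitive_idempotent ef.1 & t i * ef.1 = t i].
    have [/regular_summandP[e [f [ef1 ef fe TE]]] indT /set_mem Ti] := Tt i.
    exists (e, f); rewrite TE in indT Ti; split=> //.
    have [ee _] := complemented_idempotent ef1 ef.
    by have /(indecomposable_principalP ee)[] := indT.
  have [ef efP] := choice exe; pose e i := (ef i).1.
  have eq_or_ortho i j : e i = e j \/ orthogonal_elts (e i) (e j).
    have [? ? ? ? _] := efP i; have [? ? ? ? _] := efP j.
    exact: (primitive_complemented_eq_or_orthogonal hR
              (f := (ef i).2) (f' := (ef j).2)).
  (* Several [T i] may yield the same idempotent, which must be counted once in the sum. *)
  pose s := undup (codom e).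
  have sP x : x \in s -> exists i, x = e i.
    by rewrite mem_undup => /codomP.
  exists [set` s]; split; first exact: finite_seq.
  + by move=> _ /sP[i ->]; have [] := efP i.
  + by move=> _ _ /sP[i ->] /sP[j ->] neij; have [/neij|] := eq_or_ortho i j.
  have {}sum1 : \sum_i (t i : R) = 1 by exact: esym sum1.
  (* With S the sum over [s], S = 1 S is the sum of the [t i] S. Each [t i] S equals [t i * e i] S,
     which is [t i * e i = t i] because [e i] kills the other members of [s]. *)
  rewrite -fsbig_seq ?undup_uniq // -[LHS]mul1r -sum1 mulr_suml.
  apply: eq_bigr => i _.
  have [_ _ _ [ei _] <-] := efP i.
  rewrite -mulrA mulr_sumr (bigD1_seq (e i)) ?undup_uniq //=; last first.
    by rewrite mem_undup codom_f.
  rewrite ei big_seq_cond big1 ?addr0 // => _ /andP[/sP[j ->] /eqP neji].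
  by have [/esym/neji|[]] := eq_or_ortho i j.
- move=> [E [finE prim ortho sum1]].
  have [s0 E_s0] := (finite_seqP E).1 finE.
  (* [0] may belong to [E], but it would give a zero summand, which is not indecomposable; dropping
     it leaves the sum unchanged. *)
  pose s := [seq x <- undup s0 | x != 0].
  have sE x : x \in s -> E x.
    by rewrite mem_filter mem_undup E_s0 => /andP[].
  have uniq_s : uniq s by rewrite filter_uniq ?undup_uniq.
  have sE' i : E (tnth (in_tuple s) i) by apply: sE; apply: mem_tnth.
  have We : complete_orthogonal (tnth (in_tuple s)).
    split=> [i j|].
      have [<-|neij] := eqVneq i j; first exact: (prim _ (sE' i)).1.
      apply: (ortho _ _ (sE' i) (sE' j) _).1 => /eqP.
      by rewrite !(tnth_nth 0) nth_uniq // => /eqP/val_inj/eqP; apply/negP.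
    rewrite -[LHS](big_tnth _ _ s xpredT id) big_filter big_mkcond /=.
    have -> : \sum_(x <- undup s0) (if x != 0 then x else 0) =
        \sum_(x <- undup s0) x.
      by apply: eq_bigr => x _; case: eqVneq.
    rewrite fsbig_seq ?undup_uniq // -sum1 E_s0; congr (\sum_(x \in _) x).
    by apply/seteqP; split=> x /=; rewrite mem_undup.
  exists (size s), (fun i => principal (tnth (in_tuple s) i)).
  have dW : direct_sum (fun i => principal (tnth (in_tuple s) i)).
    by apply/regular_direct_sumP; exists (tnth (in_tuple s)).
  split=> // i; split.
    apply/indecomposable_principalP; first exact: (prim _ (sE' i)).1.
    split; last exact: prim.
    by have := mem_tnth i (in_tuple s); rewrite mem_filter => /andP[/eqP].
  exact: projective_regular_summand (regular_direct_summand i dW).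
- move=> [n [W [dW indW]]]; apply/seteqP; split=> // v _.
  (* The components of [v] along the [W i] witness its membership in the socle. *)
  have [w Ww ->] := ((direct_sumP W).1 dW).1 v.
  exists n, W, w; split=> // i; split; last exact: mem_set.
    exact: (regular_direct_summand i dW).
  exact: (indW i).1.
Qed.
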